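(* For every real $\varepsilon$ with $0<\varepsilon<0.01$ there is a constant $c'=c'(\varepsilon)>0$ such that the following holds. Let $n,r,k$ be positive integers with $1\le r\le(1-\varepsilon)n$ and $k\ge6/\varepsilon$. Consider the symmetric group $S_n$ endowed with the Hamming distance $\Delta$. (1) $(S_n,\Delta)$ has exponential growth at radius $r$ with rate $\varepsilon$. (2) $(S_n,\Delta)$ is $(r,k)$-dispersed with constant $\varepsilon/4$. (3) For any $a,b\in S_n$ with $\Delta(a,b)=k$ and any integer $i$ with $0\le i\le\varepsilon k/4$, $\ell_{a,b}(\mathbf x)-\mathbb E\,\ell_{a,b}(\mathbf x)$ is $72r$-subgaussian, where $\mathbf x$ is drawn uniformly from $S(a,r-i)$. Consequently, for every $a,b\in S_n$ with $\Delta(a,b)\ge6/\varepsilon$, $$\frac{|B(a,r)\cap B(b,r)|}{|B(a,r)|}\le2\exp\left(-c'\left(\Delta(a,b)+\frac{\Delta(a,b)^2}{r}\right)\right).$$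
   Context: The Hamming distance on $S_n$ is $\Delta(\sigma,\tau)=|\{i\in[n]:\sigma(i)\ne\tau(i)\}|$. With $X=S_n$: $B(a,s)=\{x\in X:\Delta(x,a)\le s\}$, $S(a,s)=\{x\in X:\Delta(x,a)=s\}$, and $\ell_{a,b}(x)=\Delta(x,b)-\Delta(x,a)$. Exponential growth at radius $r$ with rate $c$: for every $a\in X$ and every integer $t$ with $0\le t<r$, $|B(a,r-t)|\le2e^{-ct}|B(a,r)|$. $(r,k)$-dispersed with constant $\alpha$: for any $a,b\in X$ at distance exactly $k$ and any integer $i$ with $0\le i\le\alpha k$, $\mathbb E_{\mathbf x\sim S(a,r-i)}[\ell_{a,b}(\mathbf x)]\ge2\alpha k$, with $\mathbf x$ uniform on $S(a,r-i)$. A real random variable $\mathbf Y$ is $K$-subgaussian if $\mathbb P(|\mathbf Y|\ge t)\le2\exp(-t^2/K)$ for all $t\ge0$. Convention: conditions on a uniform random point of $S(a,r-i)$ are vacuous when $S(a,r-i)$ is empty. *)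

(* Defs.v *)
From HB Require Import structures.
From mathcomp Require Import all_boot all_order all_algebra all_fingroup.
From mathcomp Require Import reals sequences exp.

Set Implicit Arguments.
Unset Strict Implicit.
Unset Printing Implicit Defensive.

Import Order.TTheory GRing.Theory Num.Theory.
Local Open Scope ring_scope.

Definition hamming (n : nat) (s t : 'S_n) : nat := #|[set i | s i != t i]|.

(* [unifE A f] and [unifP A p] divide by [#|A|], so they only have their
   probabilistic meaning when [A] is nonempty. *)
Section Uniform.
Context {R : realType} {T : finType}.

Definition unifE (A : {set T}) (f : T -> R) : R :=
  (\sum_(x in A) f x) / #|A|%:R.

Definition unifP (A : {set T}) (p : pred T) : R :=
  #|[set x in A | p x]|%:R / #|A|%:R.

Definition subgaussian (A : {set T}) (Y : T -> R) (K : R) : Prop :=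
  forall t : R, 0 <= t ->
    unifP A [pred x | t <= `|Y x|] <= 2 * expR (- (t ^+ 2 / K)).

End Uniform.

Section FiniteMetric.
Context {R : realType} {T : finType}.
Implicit Types (d : T -> T -> nat) (a b x : T).

(* Radii are integers rather than naturals: [msphere d a (r%:Z - i%:Z)] has to be
   empty when [r < i], whereas truncated subtraction would give radius 0. *)
Definition mball d a (s : int) : {set T} := [set x | (d x a)%:Z <= s].

Definition msphere d a (s : int) : {set T} := [set x | (d x a)%:Z == s].

Definition ell d a b x : R := (d x b)%:R - (d x a)%:R.

Definition exponential_growth d (r : nat) (c : R) : Prop :=
  forall a (t : nat), (t < r)%N ->
    #|mball d a (r%:Z - t%:Z)|%:R <= 2 * expR (- (c * t%:R)) * #|mball d a r%:Z|%:R.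

Definition dispersed d (r k : nat) (alpha : R) : Prop :=
  forall a b, d a b = k ->
  forall i : nat, i%:R <= alpha * k%:R ->
    msphere d a (r%:Z - i%:Z) != set0 ->
    2 * alpha * k%:R <= unifE (msphere d a (r%:Z - i%:Z)) (ell d a b).

End FiniteMetric.

(* Main.v *)
Require Import Defs.
From HB Require Import structures.
From mathcomp Require Import all_boot all_order all_algebra all_fingroup.
From mathcomp Require Import reals sequences exp.
From mathcomp Require Import functions topology normedtype derive realfun.
From mathcomp Require Import ring lra zify.

Set Implicit Arguments.
Unset Strict Implicit.
Unset Printing Implicit Defensive.

Import Order.TTheory GRing.Theory Num.Theory.
Local Open Scope ring_scope.

(** The Hamming distance on S_n is invariant under multiplication on both
    sides, so the centre [a] may be moved to the identity, and the balls and
    spheres around the identity are unions of conjugacy classes.  A uniform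
    point [x] of such a set has the same law as [x ^ p] with [p] an independent
    uniform permutation ([unifE_conj]).  Everything about [ell] therefore
    reduces to the random variable [hamming (x ^ p) b], with [x] and [b] fixed,
    [s] and [k] the numbers of points that they move, and [p] uniform.

    Mean.  Since S_n is 2-transitive, the probability that [x ^ p] maps [i] to
    [j] depends only on whether [i = j].  Hence the mean of [ell] depends only
    on [n], [s] and [k] ([mean_hamming_conj], [mean_ell]): a point moved by [b]
    contributes [(n - s) / n], the chance of being fixed, minus
    [s / (n * (n - 1))], the chance of being mapped as [b] does.  The first term
    is at least [eps] and the second at most [eps / 2], which is dispersion.
    The mean does not depend on the cycle type of [x], so concentration on a
    whole sphere follows from concentration on each conjugacy class.

    Concentration.  Multiplying [p] by a transposition changes at most four
    values of [x ^ p], and [x ^ p] depends only on the images under [p] of the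
    [s] points moved by [x].  Revealing these images one at a time gives a
    martingale with [s] steps of size at most 4 ([mgf_agree]), hence the tail
    [2 * exp (- t ^ 2 / (64 * s))].  Conjugating by [p^-1] exchanges the roles
    of [x] and [b], so [s] may be replaced by [k] ([hamming_conj_tail]).

    Growth.  A point fixed by [x] can be inserted into a cycle of [x] right
    after any moved point; counting the results shows that consecutive
    spheres, and then balls, grow by a factor of at least 4/3 ([card_ball_growth]).

    Intersection.  If [2 * r < k] the two balls are disjoint.  Otherwise
    [k ^ 2 / r <= 2 * k], so a bound exponential in [k] is enough.  The proxy
    [72 * r] would only give the exponent [k ^ 2 / r], which can be much smaller
    than [k]; the tail with proxy [64 * k] gives an exponent of order [k].
    Points of the intersection at distance at most [r - M - 1] from [a], where
    [M] is the integer part of [eps * k / 4], are few by growth; at the others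
    [ell] is at most [M], that is, [eps * k / 4] or more below its mean. *)

(** * Averages and exponential moments on a finite set *)

Section ExponentialBounds.
Import numFieldNormedType.Exports.

(** The function [z |-> (1 + z + z ^ 2) * exp (- z)] has derivative
    [z * (1 - z) * exp (- z)], so on [z <= 1] it is least at 0. *)
Lemma expR_le_quadratic (R : realType) (y : R) : y <= 1 -> expR y <= 1 + y + y ^+ 2.
Proof.
move=> y1; rewrite expr2.
pose g (z : R) := (1 + z + z * z) * expR (- z).
have dg (z : R) : is_derive z 1 g (z * (1 - z) * expR (- z)).
  have -> : g = ((cst 1 + id + id * id) * (expR \o -%R) : R -> R) by [].
  have de : is_derive z 1 (expR \o -%R : R -> R) (expR (- z) * - 1).
    exact: is_derive1_comp.
  have dq : is_derive z 1 (cst 1 + id + id * id : R -> R) (0 + 1 + (z * 1 + z * 1)).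
    exact: is_deriveD.
  have -> : z * (1 - z) * expR (- z)
      = (1 + z + z * z) * (expR (- z) * - 1) + expR (- z) * (0 + 1 + (z * 1 + z * 1)).
    by ring.
  exact: is_deriveM dq de.
have dg' (z : R) : derivable g z 1 by have [] := dg z.
have dgE (z : R) : derive1 g z = z * (1 - z) * expR (- z).
  by rewrite derive1E; have [] := dg z.
have g0 : g 0 = 1 by rewrite /g oppr0 expR0 mulr0 !addr0 mulr1.
suff : 1 <= g y by rewrite /g expRN -ler_pdivrMr ?invr_gt0 ?expR_gt0// mul1r invrK.
have [y0|y0] := leP 0 y; rewrite -g0.
  apply: (@ger0_derive1_ndecr _ g 0 1) => //.
  - move=> z; rewrite in_itv /= => /andP[z0 z1].
    rewrite dgE.
    by rewrite !mulr_ge0 ?expR_ge0 ?subr_ge0 ?ltW.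
  - apply: derivable_within_continuous => z _; exact: (dg' z).
apply: (@ler0_derive1_nincr _ g y 0) => //; last exact: ltW.
- move=> z; rewrite in_itv /= => /andP[_ z0].
  rewrite dgE.
  rewrite !mulr_le0_ge0 ?expR_ge0 ?subr_ge0 ?ltW//.
  exact: lt_trans z0 _.
- apply: derivable_within_continuous => z _; exact: (dg' z).
Qed.

(** Replaces [cosh y <= exp (y ^ 2 / 2)] in the proof of Hoeffding's lemma: the
    linear term averages to zero.  The constant is twice as large. *)
Lemma expR_le_add_expR_sqr (R : realType) (y : R) : expR y <= y + expR (y ^+ 2).
Proof.
have [y1|/ltW y1] := leP y 1.
  apply: le_trans (expR_le_quadratic y1) _.
  by rewrite -addrA addrCA lerD2l expR_ge1Dx.
rewrite (@le_trans _ _ (expR (y ^+ 2)))//.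
  by rewrite ler_expR expr2 ler_peMl// (le_trans ler01).
by rewrite lerDr (le_trans ler01).
Qed.

End ExponentialBounds.

Section Averages.
Context {R : realType} {T : finType}.
Implicit Types (A B : {set T}) (f g : T -> R) (P Q : pred T).

Lemma natr_card_gt0 A x : x \in A -> 0 < #|A|%:R :> R.
Proof. by move=> xA; rewrite ltr0n card_gt0; apply/set0Pn; exists x. Qed.

Lemma eq_unifE A f g : {in A, f =1 g} -> unifE A f = unifE A g.
Proof. by move=> fg; rewrite /unifE (eq_bigr g). Qed.

Lemma ler_unifE A f g : {in A, forall x, f x <= g x} -> unifE A f <= unifE A g.
Proof. by move=> fg; rewrite ler_wpM2r ?invr_ge0// ler_sum. Qed.

Lemma unifEMr A f (z : R) : unifE A (fun x => f x * z) = unifE A f * z.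
Proof. by rewrite /unifE -mulr_suml mulrAC. Qed.

Lemma unifEMl A f (z : R) : unifE A (fun x => z * f x) = z * unifE A f.
Proof. by rewrite /unifE -mulr_sumr mulrA. Qed.

Lemma unifEB A f g :
  unifE A (fun x => f x - g x) = unifE A f - unifE A g.
Proof. by rewrite /unifE sumrB mulrBl. Qed.

Lemma sumr_cst A (z : R) : \sum_(x in A) z = z * #|A|%:R.
Proof. by rewrite sumr_const mulr_natr. Qed.

Lemma unifE_cst A x (z : R) : x \in A -> unifE A (fun=> z) = z.
Proof.
move=> /natr_card_gt0 A0.
by rewrite /unifE sumr_cst mulfK ?gt_eqF.
Qed.

Lemma sum_unifE A f : \sum_(x in A) f x = unifE A f * #|A|%:R.
Proof.
have [->|[x /natr_card_gt0 A0]] := set_0Vmem A.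
  by rewrite big_set0 cards0 mulr0.
by rewrite divfK ?gt_eqF.
Qed.

Lemma sum_center A f : \sum_(x in A) (f x - unifE A f) = 0.
Proof.
by rewrite sumrB sum_unifE sumr_cst subrr.
Qed.

(** A form of Hoeffding's lemma with a weaker constant. *)
Lemma unifE_expR_centered A f (c : R) :
    \sum_(x in A) f x = 0 -> {in A, forall x, `|f x| <= c} ->
  unifE A (fun x => expR (f x)) <= expR (c ^+ 2).
Proof.
move=> f0 fc.
have [->|[x xA]] := set_0Vmem A.
  by rewrite /unifE big_set0 mul0r expR_ge0.
rewrite ler_pdivrMr ?(natr_card_gt0 xA)//.
have -> : expR (c ^+ 2) * #|A|%:R = \sum_(x in A) (f x + expR (c ^+ 2)).
  by rewrite big_split /= f0 add0r sumr_cst.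
apply: ler_sum => y yA; apply: le_trans (expR_le_add_expR_sqr _) _.
rewrite lerD2l ler_expR -real_normK ?num_real//.
by rewrite lerXn2r ?nnegrE ?(le_trans _ (fc _ yA)) ?fc.
Qed.

(** The tower property of conditional expectation: the sets [C x] are the
    classes of an equivalence relation on [A]. *)
Lemma unifE_tower A (C : T -> {set T}) f :
    {in A, forall x, x \in C x} -> {in A, forall x, C x \subset A} ->
    {in A, forall x y, y \in C x -> C y = C x} ->
  unifE A (fun x => unifE (C x) f) = unifE A f.
Proof.
move=> Cx CA CE; rewrite /unifE; congr (_ / _).
transitivity (\sum_(x in A) \sum_(y in A | y \in C x) f y / #|C y|%:R).
  apply: eq_bigr => x xA; rewrite mulr_suml; apply: eq_big => [y|y yC].
    by rewrite andb_idl//; exact/subsetP/CA.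
  by rewrite (CE x).
rewrite (exchange_big_dep (fun y => y \in A)) => [/=|//].
  apply: eq_bigr => y yA.
  rewrite (eq_bigl (fun x => x \in C y)) => [|x].
    rewrite sumr_cst divfK// gt_eqF// (@natr_card_gt0 _ y)//.
    exact: Cx.
  apply/andP/idP => [[xA /andP[_ yC]]|xC]; first by rewrite (CE x xA y yC) Cx.
  have xA : x \in A by apply: subsetP xC; exact: CA.
  by rewrite (CE y yA x xC) xA yA Cx.
by move=> x y _ /andP[].
Qed.

Lemma unifE_bound A f x (c : R) : x \in A ->
    {in A, forall y, `|f x - f y| <= c} -> `|f x - unifE A f| <= c.
Proof.
move=> xA fc; have A0 := natr_card_gt0 xA.
have -> : f x - unifE A f = (\sum_(y in A) (f x - f y)) / #|A|%:R.
  by rewrite sumrB sumr_cst mulrBl mulfK ?gt_eqF//.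
rewrite normrM [X in _ * X]gtr0_norm ?invr_gt0// ler_pdivrMr//.
apply: le_trans (ler_norm_sum _ _ _) _.
by rewrite -sumr_cst ler_sum.
Qed.

Lemma unifE_reindex A B (h : T -> T) f :
  injective h -> h @: A = B -> unifE B f = unifE A (f \o h).
Proof.
move=> hI <-; rewrite /unifE card_imset// big_imset//=.
by move=> ? ? _ _; exact: hI.
Qed.

Lemma unifE_sum (I : finType) A (P : pred I) (F : I -> T -> R) :
  unifE A (fun x => \sum_(k | P k) F k x) = \sum_(k | P k) unifE A (F k).
Proof. by rewrite /unifE exchange_big mulr_suml. Qed.

Lemma unifPE A P : unifP A P = unifE A (fun x => (P x)%:R) :> R.
Proof.
rewrite /unifP /unifE -sum1dep_card natr_sum big_mkcondr.
by congr (_ / _); apply: eq_bigr => x _; case: (P x).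
Qed.

Lemma le_unifP A P Q : {in A, forall x, P x -> Q x} -> unifP A P <= unifP A Q :> R.
Proof.
move=> PQ; rewrite !unifPE; apply: ler_unifE => x xA.
by have := PQ x xA; case: (P x) => [->//|_]; case: (Q x).
Qed.

(** Chernoff's bound. *)
Lemma unifP_le_mgf A f (l t : R) : 0 <= l ->
  unifP A [pred x | t <= f x] <= unifE A (fun x => expR (l * f x)) * expR (- (l * t)).
Proof.
move=> l0; rewrite unifPE -unifEMr; apply: ler_unifE => x _ /=.
rewrite -expRD; case: (leP t (f x)) => [tf|_]; last by rewrite mulr0n expR_ge0.
by rewrite -expR0 ler_expR -mulrBr mulr_ge0 ?subr_ge0.
Qed.

Lemma unifP_norm_le A f (t : R) :
  unifP A [pred x | t <= `|f x|]
  <= unifP A [pred x | t <= f x] + unifP A [pred x | t <= - f x] :> R.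
Proof.
rewrite !unifPE /unifE -mulrDl -big_split ler_wpM2r ?invr_ge0//= ler_sum// => x _.
rewrite ler_normr; case: (t <= f x) => /=; first by rewrite lerDl.
by rewrite add0r.
Qed.

End Averages.

(** * Azuma's inequality for functions of a random permutation *)

Section Azuma.
Context {R : realType} {T : finType}.
Implicit Types (P Q U : {set T}) (p s : {perm T}) (f : {perm T} -> R).

(** The permutations that are still possible once the values of [p] on [P] have
    been revealed: the atom containing [p] of the filtration used below. *)
Definition agree P p : {set {perm T}} := [set s : {perm T} | [forall j in P, s j == p j]].

Lemma agreeP P p s : reflect {in P, s =1 p} (s \in agree P p).
Proof.
rewrite inE; apply: (iffP forall_inP) => H j jP; first exact/eqP/H.
by apply/eqP/H.
Qed.

Lemma agree_refl P p : p \in agree P p.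
Proof. exact/agreeP. Qed.

Lemma agree_eq P p s : s \in agree P p -> agree P s = agree P p.
Proof.
move=> /agreeP sp; apply/setP => t.
apply/agreeP/agreeP => tE j jP; first by rewrite tE// sp.
by rewrite tE// sp.
Qed.

Lemma agree_sub P Q p : P \subset Q -> agree Q p \subset agree P p.
Proof.
move=> /subsetP PQ; apply/subsetP => s /agreeP sp; apply/agreeP => j /PQ.
exact: sp.
Qed.

Definition swap_lip f (c : R) := forall p u v, `|f (p * tperm u v)%g - f p| <= c.

(** The value revealed at [x] can be changed from [p x] to [s x] by swapping
    these two values afterwards.  This couples the two conditional laws. *)
Lemma agree_swap P x p s : x \notin P -> s \in agree P p ->
  unifE (agree (x |: P) s) =1
  fun f => unifE (agree (x |: P) p) (fun t => f (t * tperm (p x) (s x))%g).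
Proof.
move=> xP /agreeP sp f.
have sur : [set (t * tperm (p x) (s x))%g | t in agree (x |: P) p]
           = agree (x |: P) s.
  have key (q r t : {perm T}) : {in P, r =1 q} -> t \in agree (x |: P) q ->
      (t * tperm (q x) (r x))%g \in agree (x |: P) r.
    move=> rq /agreeP tq; apply/agreeP => j; rewrite permM => jP.
    rewrite tq//; move: jP; rewrite !inE => /orP[/eqP->|jP].
      by rewrite tpermL.
    have jx : j != x by apply: contraNneq xP => <-.
    by rewrite -(rq j jP) tpermD ?(inj_eq perm_inj) 1?eq_sym// rq// (inj_eq perm_inj).
  apply/setP => t; apply/imsetP/idP => [[q qp ->]|ts]; first exact: key.
  exists (t * tperm (p x) (s x))%g; last by rewrite -mulgA tperm2 mulg1.
  by rewrite tpermC; apply: key => // j jP; rewrite sp.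
rewrite /unifE -sur card_imset; last exact: mulIg.
by rewrite big_imset//= => q r _ _; exact: mulIg.
Qed.

(** A martingale increment is bounded by the effect of one transposition,
    because the coupled permutations differ by exactly one. *)
Lemma agree_mean_lip f c P x p s : swap_lip f c -> x \notin P ->
    s \in agree P p ->
  `|unifE (agree (x |: P) p) f - unifE (agree (x |: P) s) f| <= c.
Proof.
move=> fc xP sp; rewrite (agree_swap xP sp) distrC /unifE -mulrBl -sumrB.
have A0 := @natr_card_gt0 R _ _ _ (agree_refl (x |: P) p).
rewrite normrM [X in _ * X]gtr0_norm ?invr_gt0// ler_pdivrMr//.
apply: le_trans (ler_norm_sum _ _ _) _.
by rewrite -sumr_cst ler_sum.
Qed.

(** Azuma's inequality for the martingale that reveals the values on [U]: by
    induction on the number of points of [U] not yet revealed, each step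
    multiplies the exponential moment by at most [exp (c ^ 2)].  Once [U] is
    revealed, [f] is constant. *)
Lemma mgf_agree f c U P p : swap_lip f c ->
    (forall q s : {perm T}, {in U, q =1 s} -> f q = f s) ->
  unifE (agree P p) (fun s => expR (f s - unifE (agree P p) f))
  <= expR (c ^+ 2 * #|U :\: P|%:R).
Proof.
move=> fc fU; move En : #|_| => n.
elim: n P p En => [|n IH] P p En.
  rewrite mulr0 expR0.
  move/eqP: En; rewrite cards_eq0 setD_eq0 => /subsetP UP.
  have fE : {in agree P p, forall s, f s = f p}.
    by move=> s /agreeP sp; apply: fU => j /UP; exact: sp.
  rewrite (eq_unifE fE) (unifE_cst _ (agree_refl P p)).
  rewrite (@eq_unifE _ _ _ _ (fun=> 1)) ?(unifE_cst _ (agree_refl P p))//.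
  by move=> s sp; rewrite fE// subrr expR0.
have /card_gt0P[x] : (0 < #|U :\: P|)%N by rewrite En.
rewrite inE => /andP[xP xU].
have En' : #|U :\: (x |: P)| = n.
  move: En; rewrite (cardsD1 x (U :\: P)) !inE xP xU => -[<-].
  by apply: eq_card => j; rewrite !inE negb_or andbA.
set A := agree P p; set mu := unifE A f.
pose C s := agree (x |: P) s; pose h s := unifE (C s) f.
have CA : {in A, forall s, C s \subset A}.
  by move=> s sA; rewrite /A -(agree_eq sA); exact/agree_sub/subsetUr.
have tower g : unifE A (fun s => unifE (C s) g) = unifE A g.
  apply: unifE_tower => //; first by move=> s _; exact: agree_refl.
  by move=> s _ t; exact: agree_eq.
rewrite -tower.
apply: (@le_trans _ _
    (unifE A (fun s => expR (h s - mu) * expR (c ^+ 2 * n%:R)))).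
  apply: ler_unifE => s sA.
  rewrite (@eq_unifE _ _ _ _ (fun t => expR (h s - mu) * expR (f t - h s))).
    by rewrite unifEMl ler_wpM2l ?expR_ge0// IH.
  by move=> t _; rewrite -expRD; congr expR; ring.
rewrite unifEMr -natr1 mulrDr mulr1 addrC expRD ler_wpM2r ?expR_ge0//.
have muE : mu = unifE A h by rewrite /mu -tower.
apply: unifE_expR_centered => [|s sA]; first by rewrite muE sum_center.
rewrite muE; apply: unifE_bound => // t tA; apply: agree_mean_lip => //.
by rewrite (agree_eq sA).
Qed.

End Azuma.

Section Tail.
Context {R : realType} {T : finType}.
Implicit Types (f : {perm T} -> R).

Lemma swap_lip_upper_tail f (c : R) (U : {set T}) (m : nat) (t : R) :
    0 < c -> swap_lip f c -> (forall p q : {perm T}, {in U, p =1 q} -> f p = f q) ->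
    (#|U| <= m)%N -> (0 < m)%N -> 0 <= t ->
  unifP setT [pred p | t <= f p - unifE setT f]
    <= expR (- (t ^+ 2 / (4 * c ^+ 2 * m%:R))).
Proof.
move=> c0 fc fU Um m0 t0.
have m0R : 0 < m%:R :> R by rewrite ltr0n.
(* The minimizer of [l ^ 2 * c ^ 2 * m - l * t]. *)
pose l := t / (2 * c ^+ 2 * m%:R).
have l0 : 0 <= l by rewrite divr_ge0// !mulr_ge0// ?sqr_ge0// ltW.
apply: le_trans (unifP_le_mgf _ _ _ l0) _.
have setTE : [set: {perm T}] = agree set0 1%g.
  by apply/setP => p; rewrite inE; apply/esym/agreeP => j; rewrite inE.
have glip : swap_lip (fun p => l * f p) (l * c).
  by move=> p u v; rewrite -mulrBr normrM ger0_norm// ler_wpM2l.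
have gU (p q : {perm T}) : {in U, p =1 q} -> l * f p = l * f q.
  by move=> /fU ->.
have := mgf_agree set0 1%g glip gU; rewrite -setTE setD0 => mgf.
have -> : expR (- (t ^+ 2 / (4 * c ^+ 2 * m%:R)))
    = expR ((l * c) ^+ 2 * m%:R) * expR (- (l * t)).
  rewrite -expRD; congr expR; rewrite /l; field.
  by rewrite !gt_eqF.
rewrite ler_wpM2r ?expR_ge0//.
rewrite (eq_unifE (g := fun p => expR (l * f p - unifE setT (fun q => l * f q)))).
  apply: le_trans mgf _.
  by rewrite ler_expR ler_wpM2l ?sqr_ge0// ler_nat.
by move=> p _; rewrite unifEMl mulrBr.
Qed.

Lemma swap_lip_tail f (c : R) (U : {set T}) (m : nat) (t : R) :
    0 < c -> swap_lip f c -> (forall p q : {perm T}, {in U, p =1 q} -> f p = f q) ->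
    (#|U| <= m)%N -> (0 < m)%N -> 0 <= t ->
  unifP setT [pred p | t <= `|f p - unifE setT f|]
    <= 2 * expR (- (t ^+ 2 / (4 * c ^+ 2 * m%:R))).
Proof.
move=> c0 fc fU Um m0 t0; apply: le_trans (unifP_norm_le _ _ _) _.
rewrite mulr_natl mulr2n lerD ?(swap_lip_upper_tail c0 fc fU Um)//.
have NE : unifE setT (fun p => - f p) = - unifE setT f.
  by rewrite /unifE sumrN mulNr.
have := @swap_lip_upper_tail (fun p => - f p) c U m t c0 _ _ Um m0 t0.
rewrite NE => tail.
rewrite (le_trans (le_unifP _) (tail _ _))// => [p _ /=|p u v|p q /fU ->//].
  by rewrite opprD.
by rewrite -opprD normrN.
Qed.

End Tail.

(** * Hamming distance and random conjugation *)

Section Hamming.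
Variable n : nat.
Implicit Types (s t u x b p q : 'S_n).

Lemma hamming_id s : hamming s s = 0%N.
Proof. by apply: eq_card0 => i; rewrite inE eqxx. Qed.

Lemma hammingC s t : hamming s t = hamming t s.
Proof. by apply: eq_card => i; rewrite !inE eq_sym. Qed.

Lemma hamming_triangle t s u : (hamming s u <= hamming s t + hamming t u)%N.
Proof.
rewrite -cardsUI; apply: leq_trans (leq_addr _ _).
apply/subset_leq_card/subsetP => i; rewrite !inE.
by have [->|] := eqVneq (s i) (t i).
Qed.

Lemma hammingMr u s t : hamming (s * u)%g (t * u)%g = hamming s t.
Proof. by apply: eq_card => i; rewrite !inE !permM (inj_eq perm_inj). Qed.

Lemma hammingM1 u s : hamming (s * u)%g u = hamming s 1%g.
Proof. by rewrite -(hammingMr u s) mul1g. Qed.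

Lemma hamming_div s t : hamming s t = hamming (s * t^-1)%g 1%g.
Proof. by rewrite -(hammingM1 t) mulgKV. Qed.

Lemma hammingMl u s t : hamming (u * s)%g (u * t)%g = hamming s t.
Proof.
rewrite /hamming -(card_imset [set i | (u * s)%g i != (u * t)%g i] (@perm_inj _ u)).
apply: eq_card => i; rewrite inE; apply/imsetP/idP => [[j]|st].
  by rewrite inE !permM => sut ->.
by exists ((u^-1)%g i); rewrite ?inE ?permM permKV.
Qed.

Lemma hammingJ u s t : hamming (s ^ u)%g (t ^ u)%g = hamming s t.
Proof. by rewrite !conjgE hammingMl hammingMr. Qed.

Lemma hammingJ1 u s : hamming (s ^ u)%g 1%g = hamming s 1%g.
Proof. by rewrite -{1}(conj1g u) hammingJ. Qed.

Lemma hamming_tperm1 (i j : 'I_n) : (hamming (tperm i j) 1%g <= 2)%N.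
Proof.
apply: (@leq_trans #|[set i; j]|); last by rewrite cards2; case: (i != j).
apply/subset_leq_card/subsetP => k; rewrite !inE perm1.
by case: tpermP => [->|->|]; rewrite ?eqxx ?orbT.
Qed.

Lemma hamming_conj_tperm x (i j : 'I_n) : (hamming (x ^ tperm i j)%g x <= 4)%N.
Proof.
rewrite conjgE tpermV; set w := tperm i j.
apply: leq_trans (hamming_triangle (x * w)%g _ _) _.
rewrite -[4%N]/(2 + 2)%N leq_add//.
  by rewrite -{2}(mul1g (x * w)%g) hammingMr hamming_tperm1.
by rewrite -{2}(mulg1 x) hammingMl hamming_tperm1.
Qed.

(** A point fixed by [x] yields a fixed point of [x ^ p] wherever [p] sends it. *)
Lemma conjg_agree x p q : {in [set i | x i != i], (p : _ -> _) =1 q} ->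
  (x ^ p = x ^ q)%g.
Proof.
move=> pq.
suff E j : (x ^ q)%g (p j) = p (x j).
  by apply/permP => i; rewrite -[i](permKV p) E permJ.
have [xj|xj] := eqVneq (x j) j; last first.
  by rewrite !pq ?inE ?(inj_eq perm_inj)// permJ.
rewrite xj -{1}(permKV q (p j)) permJ; set j' := (q^-1)%g (p j).
suff xj' : x j' = j' by rewrite xj' permKV.
apply/eqP; apply: contraT => xj'.
have : p j' = p j by rewrite pq ?inE// permKV.
by move/perm_inj => jj'; move: xj'; rewrite jj' xj eqxx.
Qed.

Lemma hamming1E x : hamming x 1%g = #|[set i | x i != i]|.
Proof. by apply: eq_card => i; rewrite !inE perm1. Qed.

End Hamming.

Section ConjMean.
Context {R : realType} {n : nat}.
Implicit Types (s t u x b p q : 'S_n) (i j : 'I_n).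

Definition conj_hit x i j : R := unifE setT (fun p => ((x ^ p)%g i == j)%:R).

Lemma conj_hit_perm u x i j : conj_hit x (u i) (u j) = conj_hit x i j.
Proof.
rewrite /conj_hit (@unifE_reindex _ _ setT _ (fun p => p * u)%g); first last.
- by apply/setP => p; rewrite inE; apply/imsetP; exists (p * u^-1)%g; rewrite ?mulgKV.
- exact: mulIg.
by apply: eq_unifE => p _ /=; rewrite conjgM permJ (inj_eq perm_inj).
Qed.

(** This is where 2-transitivity of the symmetric group is used: one
    transposition moves [i] to [i'], a second one, fixing [i'], adjusts the
    image. *)
Lemma conj_hit_eq x i j i' j' : (i == j) = (i' == j') -> conj_hit x i j = conj_hit x i' j'.
Proof.
move=> E; rewrite -(conj_hit_perm (tperm i i')) tpermL.
have [ij|ij] := eqVneq i j.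
  by rewrite -ij tpermL; move: E; rewrite ij eqxx => /esym/eqP ->.
have : tperm i i' j != i' by rewrite (canF_eq (tpermK i i')) tpermR eq_sym.
move: (tperm i i' j) => k ki'.
by rewrite -(conj_hit_perm (tperm k j')) tpermL tpermD// eq_sym -E.
Qed.

Lemma unifE_setT_cst (z : R) : unifE [set: 'S_n] (fun=> z) = z.
Proof. by rewrite (@unifE_cst _ _ _ 1%g)// inE. Qed.

Lemma sum_conj_hit x i : \sum_j conj_hit x i j = 1.
Proof.
rewrite -unifE_sum -[RHS]unifE_setT_cst; apply: eq_unifE => p _.
rewrite (bigD1 ((x ^ p)%g i))//= eqxx big1 ?addr0// => j.
by rewrite eq_sym => /negPf ->.
Qed.

Lemma hamming_sum s t : (hamming s t)%:R = \sum_i (1 - (s i == t i)%:R) :> R.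
Proof.
rewrite /hamming -sum1dep_card natr_sum big_mkcond /=.
by apply: eq_bigr => i _; case: eqVneq => _; rewrite ?subrr ?subr0.
Qed.

(** Every conjugate of [x] has the same number of fixed points. *)
Lemma conj_hit_fix x i : conj_hit x i i * n%:R = n%:R - (hamming x 1%g)%:R.
Proof.
have -> : conj_hit x i i * n%:R = \sum_j conj_hit x j j.
  rewrite (eq_bigr (fun=> conj_hit x i i)) => [|j _]; last by apply: conj_hit_eq; rewrite !eqxx.
  by rewrite sumr_const card_ord mulr_natr.
rewrite -unifE_sum -[RHS]unifE_setT_cst; apply: eq_unifE => p _.
rewrite -(hammingJ1 p) hamming_sum sumrB sumr_const card_ord opprB addrC subrK.
by apply: eq_bigr => j _; rewrite perm1.
Qed.

(** The values [j <> i] are equally likely and share what is left by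
    [conj_hit_fix]. *)
Lemma conj_hit_move x i j : i != j ->
  conj_hit x i j * (n%:R * (n%:R - 1)) = (hamming x 1%g)%:R.
Proof.
move=> ij; have := sum_conj_hit x i; rewrite (bigD1 i)//=.
rewrite (eq_bigr (fun=> conj_hit x i j)) => [|j' ij']; last first.
  by apply: conj_hit_eq; rewrite eq_sym (negPf ij') (negPf ij).
rewrite sumr_const cardC1 card_ord -[_ *+ n.-1]mulr_natr.
have n0 : (0 < n)%N by case: (n) i {j ij} => [[]|].
have -> : n.-1%:R = n%:R - 1 :> R by rewrite -subn1 natrB.
move=> /(congr1 (fun z => z * n%:R)); rewrite mulrDl conj_hit_fix mul1r => E.
have -> : conj_hit x i j * (n%:R * (n%:R - 1)) = conj_hit x i j * (n%:R - 1) * n%:R by ring.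
by apply: (addrI (n%:R - (hamming x 1%g)%:R)); rewrite E subrK.
Qed.

Lemma mean_hamming_conj x b : (1 < n)%N ->
  let s : R := (hamming x 1%g)%:R in
  unifE setT (fun p => (hamming (x ^ p)%g b)%:R)
  = s + (hamming b 1%g)%:R * ((n%:R - s) / n%:R - s / (n%:R * (n%:R - 1))).
Proof.
move=> n1 s.
have n0 : n%:R != 0 :> R by rewrite pnatr_eq0 -lt0n ltnW.
have n10 : n%:R - 1 != 0 :> R by rewrite subr_eq0 pnatr_eq1 gtn_eqF.
have hfix i : conj_hit x i i = (n%:R - s) / n%:R by rewrite -(conj_hit_fix x i) mulfK.
have hmove i j : i != j -> conj_hit x i j = s / (n%:R * (n%:R - 1)).
  by move=> ij; rewrite /s -(conj_hit_move x ij) mulfK// mulf_neq0.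
transitivity (\sum_i (1 - conj_hit x i (b i))).
  rewrite (eq_unifE (g := fun p => \sum_i (1 - ((x ^ p)%g i == b i)%:R))).
    rewrite unifE_sum; apply: eq_bigr => i _.
    by rewrite -[X in X - _]unifE_setT_cst /conj_hit /unifE -mulrBl -sumrB.
  by move=> p _; exact: hamming_sum.
transitivity (\sum_i (1 - (n%:R - s) / n%:R
    + (1 - (b i == (1%g : 'S_n) i)%:R) * ((n%:R - s) / n%:R - s / (n%:R * (n%:R - 1))))).
  apply: eq_bigr => i _; rewrite perm1.
  case: eqVneq => [->|bi]; first by rewrite hfix subrr mul0r addr0.
  by rewrite hmove 1?eq_sym// !subr0 mul1r addrA subrK.
rewrite big_split -mulr_suml -hamming_sum sumr_const card_ord -[_ *+ n]mulr_natr /=.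
by congr (_ + _); field; rewrite n0.
Qed.

End ConjMean.

(** The mean of [ell] with respect to the identity and [b], when [b] moves [k]
    points, over any conjugacy class of permutations that move [m] points. *)
Definition drift {R : realType} (n m k : nat) : R :=
  k%:R * ((n%:R - m%:R) / n%:R - m%:R / (n%:R * (n%:R - 1))).

Section Conjugation.
Context {R : realType} {n : nat}.
Implicit Types (s t u x a b p q : 'S_n) (A : {set 'S_n}) (f : 'S_n -> R).

Definition conj_dist x b p : R := (hamming (x ^ p)%g b)%:R.

(** By [conjg_agree] at most [m] values of [p] matter, and swapping two values
    of [p] conjugates [x ^ p] by a transposition, which is a move of length at
    most 4. *)
Lemma hamming_conj_tail_support x b (m : nat) (t : R) :
    (hamming x 1%g <= m)%N -> (0 < m)%N -> 0 <= t ->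
  unifP setT [pred p | t <= `|conj_dist x b p - unifE setT (conj_dist x b)|]
    <= 2 * expR (- (t ^+ 2 / (64 * m%:R))).
Proof.
move=> xm m0 t0; set F := conj_dist x b.
have Flip : swap_lip F 4.
  move=> p i j; rewrite /F /conj_dist conjgM; set y := (x ^ p)%g.
  have := hamming_conj_tperm y i j; set z := (y ^ _)%g => zy.
  have zb := hamming_triangle y z b; have yb := hamming_triangle z y b.
  rewrite (hammingC y z) in yb.
  rewrite ler_norml lerBlDl lerBrDl -!natrD !ler_nat.
  rewrite lerBlDr -natrD ler_nat; apply/andP; split; lia.
have FU (p q : 'S_n) : {in [set i | x i != i], p =1 q} -> F p = F q.
  by rewrite /F /conj_dist => /conjg_agree ->.
have := swap_lip_tail (ltr0n R 4) Flip FU.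
rewrite -hamming1E => /(_ _ _ xm m0 t0).
by have -> : 64 * m%:R = 4 * 4 ^+ 2 * m%:R :> R by ring.
Qed.

(** The tail bound holds with the smaller of the two supports, because
    [hamming (x ^ p) b = hamming (b ^ p^-1) x] and [p^-1] is uniform when [p]
    is. *)
Lemma hamming_conj_tail x b (m : nat) (t : R) :
    (minn (hamming x 1%g) (hamming b 1%g) <= m)%N -> (0 < m)%N -> 0 <= t ->
  unifP setT [pred p | t <= `|conj_dist x b p - unifE setT (conj_dist x b)|]
    <= 2 * expR (- (t ^+ 2 / (64 * m%:R))).
Proof.
move=> + m0 t0; rewrite geq_min => /orP[xm|bm].
  exact: hamming_conj_tail_support.
have invS : @invg 'S_n @: setT = setT.
  by apply/setP => p; rewrite inE; apply/imsetP; exists p^-1%g; rewrite ?invgK.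
have FG p : conj_dist x b p^-1%g = conj_dist b x p.
  by rewrite /conj_dist -(hammingJ p) -conjgM mulVg conjg1 hammingC.
have FGE : unifE setT (conj_dist x b) = unifE setT (conj_dist b x).
  by rewrite (unifE_reindex _ (@invg_inj _) invS); apply: eq_unifE => p _; exact: FG.
apply: le_trans (hamming_conj_tail_support x bm m0 t0).
rewrite FGE !unifPE (unifE_reindex _ (@invg_inj _) invS).
by apply: ler_unifE => p _ /=; rewrite FG.
Qed.

Definition conj_closed A := forall x p, x \in A -> (x ^ p)%g \in A.

(** Conjugation by a fixed permutation is a bijection of [A], so averaging over
    the conjugating permutation as well changes nothing. *)
Lemma unifE_conj A f : conj_closed A ->
  unifE A f = unifE A (fun x => unifE setT (fun p => f (x ^ p)%g)).
Proof.
move=> AJ; transitivity (unifE setT (fun p => unifE A (fun x => f (x ^ p)%g))).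
  rewrite -[LHS](unifE_setT_cst (n := n)); apply: eq_unifE => p _.
  rewrite (@unifE_reindex _ _ A _ (fun x => x ^ p)%g)//; first exact: conjg_inj.
  apply/setP => x; apply/imsetP/idP => [[y yA ->]|xA]; first exact: AJ.
  by exists (x ^ p^-1)%g; rewrite ?AJ ?conjgKV.
rewrite /unifE -!mulr_suml exchange_big /= mulrAC; congr (_ / _ / _).
Qed.

Lemma mball1_conj (s : int) : conj_closed (mball (@hamming n) 1%g s).
Proof. by move=> x p; rewrite !inE hammingJ1. Qed.

Lemma msphere1_conj (s : int) : conj_closed (msphere (@hamming n) 1%g s).
Proof. by move=> x p; rewrite !inE hammingJ1. Qed.

Lemma mball_shift a (r : int) :
  (fun x => x * a)%g @: mball (@hamming n) 1%g r = mball (@hamming n) a r.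
Proof.
apply/setP => x; rewrite inE; apply/imsetP/idP => [[y]|xs].
  by rewrite inE => ys ->; rewrite hammingM1.
by exists (x * a^-1)%g; rewrite /= ?mulgKV// inE -hamming_div.
Qed.

Lemma msphere_shift a (r : int) :
  (fun x => x * a)%g @: msphere (@hamming n) 1%g r = msphere (@hamming n) a r.
Proof.
apply/setP => x; rewrite inE; apply/imsetP/idP => [[y]|xs].
  by rewrite inE => ys ->; rewrite hammingM1.
by exists (x * a^-1)%g; rewrite /= ?mulgKV// inE -hamming_div.
Qed.

Lemma card_mball a (r : int) :
  #|mball (@hamming n) a r| = #|mball (@hamming n) 1%g r|.
Proof. by rewrite -mball_shift card_imset//; exact: mulIg. Qed.

Lemma ell_shift a b x :
  ell (@hamming n) a b (x * a)%g = ell (@hamming n) 1%g (b * a^-1)%g x :> R.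
Proof.
by rewrite /ell hammingM1 -(hammingMr a x (b * a^-1)%g) mulgKV.
Qed.

Lemma mean_ell_conj x b : (1 < n)%N ->
  unifE setT (fun p => ell (@hamming n) 1%g b (x ^ p)%g)
  = drift n (hamming x 1%g) (hamming b 1%g) :> R.
Proof.
move=> n1; have E := @mean_hamming_conj R _ x b n1.
rewrite (eq_unifE (g := fun p => (hamming (x ^ p)%g b)%:R - (hamming x 1%g)%:R)).
  by rewrite unifEB E unifE_setT_cst addrAC subrr add0r.
by move=> p _; rewrite /ell hammingJ1.
Qed.

Lemma mean_ell a b (m : nat) : (1 < n)%N ->
    msphere (@hamming n) a m%:Z != set0 ->
  unifE (msphere (@hamming n) a m%:Z) (ell (@hamming n) a b) = drift n m (hamming a b) :> R.
Proof.
move=> n1 /set0Pn[y ym].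
rewrite (unifE_reindex _ (@mulIg _ a) (msphere_shift a m%:Z)) (unifE_conj _ (@msphere1_conj m%:Z)).
rewrite (eq_unifE (g := fun=> drift n m (hamming a b))).
  rewrite (@unifE_cst _ _ _ (y * a^-1)%g)//.
  by move: ym; rewrite !inE hamming_div.
move=> x; rewrite inE eqz_nat => /eqP xm.
rewrite -xm (hammingC a b) (hamming_div b a) -mean_ell_conj//.
by apply: eq_unifE => p _; rewrite /= ell_shift.
Qed.

(** On a sphere the mean of [ell] over each conjugacy class is the mean over the
    whole sphere, so the tail bound for one class carries over. *)
Lemma ell_tail a b (m M : nat) (t : R) : (1 < n)%N ->
    (m <= M)%N -> (0 < M)%N -> 0 <= t ->
    msphere (@hamming n) a m%:Z != set0 ->
  unifP (msphere (@hamming n) a m%:Z)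
      [pred x | t <= `|ell (@hamming n) a b x
                       - unifE (msphere (@hamming n) a m%:Z) (ell (@hamming n) a b)|]
    <= 2 * expR (- (t ^+ 2 / (64 * M%:R))).
Proof.
move=> n1 mM M0 t0 A0; have := A0 => /set0Pn[y ym].
rewrite unifPE (unifE_reindex _ (@mulIg _ a) (msphere_shift a m%:Z)) (unifE_conj _ (@msphere1_conj m%:Z)).
rewrite -[leRHS](@unifE_cst R _ (msphere (@hamming n) 1%g m) (y * a^-1)%g); last first.
  by move: ym; rewrite !inE hamming_div.
apply: ler_unifE => x; rewrite inE eqz_nat => /eqP xm.
have := @hamming_conj_tail x (b * a^-1)%g M t; rewrite xm geq_min mM => /(_ isT M0 t0).
rewrite unifPE; apply: le_trans; apply: ler_unifE => p _ /=.
rewrite ell_shift mean_ell// mean_hamming_conj// xm.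
have -> : hamming a b = hamming (b * a^-1)%g 1%g.
  by rewrite hammingC hamming_div.
by rewrite /ell hammingJ1 xm /drift opprD addrA.
Qed.

End Conjugation.

Lemma drift_ge (R : realType) (eps : R) (n m k : nat) :
    0 < eps < 1 / 100 -> m%:R <= (1 - eps) * n%:R -> 6 / eps <= n%:R :> R ->
  eps / 2 * k%:R <= drift n m k.
Proof.
move=> /andP[e0 e1] mn en.
have e600 : 600 <= 6 / eps by rewrite ler_pdivlMr//; lra.
have n0 : 0 < n%:R :> R by lra.
have n1 : 0 < n%:R - 1 :> R by lra.
rewrite /drift mulrC ler_wpM2l//.
have H1 : eps <= (n%:R - m%:R) / n%:R.
  by rewrite ler_pdivlMr//; lra.
have H2 : m%:R / (n%:R * (n%:R - 1)) <= eps / 2.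
  rewrite ler_pdivrMr ?mulr_gt0//.
  have : 2 <= eps * (n%:R - 1).
    move: en; rewrite ler_pdivrMr// mulrBr mulr1 mulrC; lra.
  move: mn; nra.
lra.
Qed.

(** * Growth of balls *)

Section Growth.
Variable n : nat.
Implicit Types (x y : 'S_n) (i j k : 'I_n) (m : nat).

Let sph m : {set 'S_n} := [set x | hamming x 1%g == m].
Let bal m : {set 'S_n} := [set x | (hamming x 1%g <= m)%N].
Let supp x : {set 'I_n} := [set i | x i != i].

Lemma card_dep_pairs (T1 T2 : finType) (A : {set T1}) (F : T1 -> {set T2}) :
  #|[set q : T1 * T2 | (q.1 \in A) && (q.2 \in F q.1)]| = (\sum_(z in A) #|F z|)%N.
Proof.
under [RHS]eq_bigr do rewrite -sum1_card.
by rewrite pair_big_dep /= sum1dep_card.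
Qed.

Lemma supp_tperm_mul x i j : x i != i -> x j = j ->
  supp (tperm i j * x)%g = j |: supp x.
Proof.
move=> xi xj; have ij : i != j by apply: contraNneq xi => ->; rewrite xj.
have xij : x i != j by rewrite -{1}xj (inj_eq perm_inj).
apply/setP => k; rewrite !inE permM.
have [->|kj] := eqVneq k j; first by rewrite tpermR.
have [->|ki] := eqVneq k i; first by rewrite tpermL xj eq_sym ij.
by rewrite tpermD// eq_sym.
Qed.

(** Double counting of pairs of permutations [x] and [y = tperm i j * x], where
    [x] moves [i] and fixes [j]: then [y] runs through the cycle of [x] with [j]
    inserted after [i].  Each [x] has [m * (n - m)] such extensions, and [y]
    with the inserted point [j] determines [i] and [x]. *)
Lemma card_sphere_switch m :
  (#|sph m| * (m * (n - m)) <= #|sph m.+1| * m.+1)%N.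
Proof.
pose D := [set q : 'S_n * ('I_n * 'I_n) |
  (q.1 \in sph m) && (q.2 \in setX (supp q.1) (~: supp q.1))].
pose E := [set q : 'S_n * 'I_n | (q.1 \in sph m.+1) && (q.2 \in supp q.1)].
have suppE x (l : nat) : x \in sph l -> #|supp x| = l.
  by rewrite inE hamming1E => /eqP.
have -> : (#|sph m| * (m * (n - m)) = #|D|)%N.
  rewrite (card_dep_pairs (sph m) (fun x => setX (supp x) (~: supp x))).
  rewrite -sum_nat_const; apply: eq_bigr => x xS.
  by rewrite cardsX (cardsCs (~: _)) setCK (suppE _ _ xS) card_ord.
have -> : (#|sph m.+1| * m.+1 = #|E|)%N.
  by rewrite (card_dep_pairs (sph m.+1) supp) -sum_nat_const; apply: eq_bigr => x /suppE.
pose phi (q : 'S_n * ('I_n * 'I_n)) := ((tperm q.2.1 q.2.2 * q.1)%g, q.2.2).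
rewrite -(card_in_imset (f := phi) (D := D)).
  apply/subset_leq_card/subsetP => _ /imsetP[[x [i j]] + ->].
  rewrite !inE /= negbK => /and3P[/eqP xm xi /eqP xj].
  have sE := supp_tperm_mul xi xj.
  move: xm; rewrite !hamming1E -/(supp _) -/(supp _) => xm.
  rewrite sE cardsU1 xm inE xj eqxx /= eqxx /=.
  by have := setU11 j (supp x); rewrite -sE inE.
move=> [x [i j]] [x' [i' j']]; rewrite !inE /= !negbK.
move=> /and3P[_ xi /eqP xj] /and3P[_ xi' /eqP xj'] [E1 E2].
rewrite -{}E2 in xj' E1 *.
have ii' : i = i'.
  apply: (@perm_inj _ (tperm i j * x)%g).
  by rewrite {2}E1 !permM !tpermL xj xj'.
by move: E1; rewrite -ii' => /mulgI ->.
Qed.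

Lemma hamming_le1 x : (hamming x 1%g <= 1)%N -> x = 1%g.
Proof.
rewrite hamming1E => x1; apply/permP => i; rewrite perm1; apply/eqP.
apply: contraTT x1 => xi; rewrite -ltnNge.
apply: leq_trans (_ : #|[set i; x i]| <= _)%N; first by rewrite cards2 eq_sym xi.
apply/subset_leq_card/subsetP => k; rewrite !inE => /orP[]/eqP -> //.
by rewrite (inj_eq perm_inj).
Qed.

Lemma hamming_tperm i j : i != j -> hamming (tperm i j) 1%g = 2%N.
Proof.
move=> ij; apply/eqP; rewrite eqn_leq hamming_tperm1 ltnNge; apply/negP.
move=> /hamming_le1 E; move: ij; have := tpermL i j.
by rewrite E perm1 => ->; rewrite eqxx.
Qed.

Lemma card_ballS m : #|bal m.+1| = (#|bal m| + #|sph m.+1|)%N.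
Proof.
have -> : bal m.+1 = bal m :|: sph m.+1.
  by apply/setP => x; rewrite !inE leq_eqVlt orbC.
rewrite cardsU; have -> : bal m :&: sph m.+1 = set0; last by rewrite cards0 subn0.
by apply/setP => x; rewrite !inE; lia.
Qed.

(** Spheres of radius at least 2 grow by the factor [2 * q / (q + 1) >= 4 / 3],
    as long as at least two points remain fixed.  The sphere of radius 1 is
    empty, so the induction starts from the ball of radius 1, a single point. *)
Lemma card_ball_growth m : (0 < m)%N -> (m.+2 <= n)%N ->
  (4 * #|bal m| <= 3 * #|bal m.+1|)%N.
Proof.
elim: m => // -[_ _ n3|m IH _ mn].
  have -> : bal 1 = [set 1%g].
    apply/setP => x; rewrite inE [RHS]inE; apply/idP/eqP => [|->].
      exact: hamming_le1.
    by rewrite hamming_id.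
  rewrite cards1.
  suff : (1 < #|bal 2|)%N by lia.
  have n0 : (0 < n)%N by lia. have n1 : (1 < n)%N by lia.
  pose w : 'S_n := tperm (Ordinal n0) (Ordinal n1).
  have w2 : hamming w 1%g = 2%N by rewrite hamming_tperm.
  apply: leq_trans (_ : #|[set w; 1%g]| <= _)%N.
    by rewrite cards2; case: eqP => // w1; move: w2; rewrite w1 hamming_id.
  apply/subset_leq_card/subsetP => x; rewrite !inE => /orP[]/eqP->; first by rewrite w2.
  by rewrite hamming_id.
have {IH} := IH isT (ltnW mn).
have := card_sphere_switch m.+2.
rewrite (card_ballS m.+2) (card_ballS m.+1); move: #|sph m.+2| #|sph m.+3| #|bal m.+1|.
move=> p q z.
have : (2 <= n - m.+2)%N by lia.
move: (n - m.+2)%N => d d2 pq zp.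
suff : (4 * p <= 3 * q)%N by lia.
have : (p * (m.+2 * 2) <= q * m.+3)%N.
  by apply: leq_trans pq; rewrite !leq_mul.
nia.
Qed.

Lemma mball1E m : mball (@hamming n) 1%g m%:Z = bal m.
Proof. by apply/setP => x; rewrite !inE lez_nat. Qed.

Lemma exponential_growth_hamming (R : realType) (eps : R) (r : nat) :
  0 <= eps <= 1 / 4 -> (r < n)%N -> exponential_growth (@hamming n) r eps.
Proof.
move=> /andP[e0 e1] rn a t tr.
rewrite !(@card_mball _ a).
suff H : #|mball (@hamming n) 1%g (r%:Z - t%:Z)|%:R
    <= expR (- (eps * t%:R)) * #|mball (@hamming n) 1%g r%:Z|%:R.
  apply: le_trans H _; rewrite ler_wpM2r// ler_peMl ?expR_ge0//; lra.
elim: t tr => [|t IH] tr.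
  by rewrite subr0 mulr0 oppr0 expR0 mul1r.
apply: le_trans (_ : expR (- eps) * #|mball (@hamming n) 1%g (r%:Z - t%:Z)|%:R <= _); last first.
  have -> : - (eps * t.+1%:R) = - eps + - (eps * t%:R) by rewrite -natr1; ring.
  rewrite expRD -mulrA ler_wpM2l ?expR_ge0//.
  by apply: IH; exact: ltnW.
have -> : r%:Z - t.+1%:Z = (r - t.+1)%N%:Z :> int by lia.
have -> : r%:Z - t%:Z = (r - t.+1).+1%:Z :> int by lia.
rewrite !mball1E.
have := @card_ball_growth (r - t.+1).
have -> : (0 < r - t.+1)%N by lia.
have -> : ((r - t.+1).+2 <= n)%N by lia.
move=> /(_ isT isT); rewrite -(ler_nat R) !natrM => G.
have E : 3 / 4 <= expR (- eps) by apply: le_trans (expR_ge1Dx _); lra.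
apply: le_trans (ler_wpM2r _ E); last exact: ler0n.
move: G; lra.
Qed.

End Growth.

(** * Intersection of two balls *)

Lemma hamming_le n (s t : 'S_n) : (hamming s t <= n)%N.
Proof. by rewrite -[leqRHS]card_ord max_card. Qed.

Lemma msphere_radius (T : finType) (d : T -> T -> nat) (a : T) (r i : nat) :
  msphere d a (r%:Z - i%:Z) != set0 ->
  exists2 m : nat, r%:Z - i%:Z = m%:Z & (m <= r)%N.
Proof.
case/set0Pn=> x; rewrite inE => /eqP xm; exists (d x a); first by rewrite xm.
by lia.
Qed.

Lemma mball_inner (T : finType) (d : T -> T -> nat) (a : T) (r t : nat) :
  [set x in mball d a r%:Z | (d x a + t <= r)%N] = mball d a (r%:Z - t%:Z).
Proof. by apply/setP => x; rewrite !inE; lia. Qed.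

Section Consequence.
Context {R : realType} {n : nat}.
Context (eps : R) (r : nat) (eps_itv : 0 < eps < 1 / 100).
Context (r_le : r%:R <= (1 - eps) * n%:R).
Implicit Types (a b x p : 'S_n).

Lemma radius_lt : 6 / eps <= n%:R :> R -> (600 < n)%N /\ (r < n)%N.
Proof.
move: eps_itv => /andP[e0 e1] en.
have e600 : 600 < 6 / eps by rewrite ltr_pdivlMr//; lra.
have n600 : 600 < n%:R :> R by lra.
split; first by move: n600; rewrite (ltr_nat R 600 n).
rewrite -(ltr_nat R); apply: le_lt_trans r_le _; nra.
Qed.

(** The tail bound is applied with proxy [64 * k], where [b] moves [k] points:
    in the outer shell, [hamming x b <= r] forces [ell] to be at most [M], which
    is [eps / 4 * k] or more below its mean. *)
Lemma outer_ball_tail b (M : nat) :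
    let k := hamming b 1%g in
    6 / eps <= k%:R :> R -> M%:R <= eps / 4 * k%:R ->
  unifP (mball (@hamming n) 1%g r%:Z)
      [pred x | (r < hamming x 1%g + M.+1)%N && (hamming x b <= r)%N]
    <= 2 * expR (- (eps ^+ 2 / 1024 * k%:R)).
Proof.
move=> k ek Mk; move: (eps_itv) => /andP[e0 e1].
have k0 : (0 < k)%N by rewrite -(ltr_nat R) (lt_le_trans _ ek)// divr_gt0.
have kn : (k <= n)%N := hamming_le b 1%g.
have en : 6 / eps <= n%:R :> R by apply: le_trans ek _; rewrite ler_nat.
have [n600 rn] := radius_lt en.
have n1 : (1 < n)%N by lia.
rewrite unifPE unifE_conj; last exact: mball1_conj.
rewrite -[leRHS](@unifE_cst R _ (mball (@hamming n) 1%g r%:Z) 1%g); last first.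
  by rewrite inE hamming_id.
apply: ler_unifE => x; rewrite inE lez_nat => xr.
have [far|close] := ltnP r (hamming x 1%g + M.+1); last first.
  rewrite (eq_unifE (g := fun=> 0)) ?unifE_setT_cst ?mulr_ge0 ?expR_ge0//.
  by move=> p _ /=; rewrite hammingJ1 ltnNge close.
pose al := eps / 4 * k%:R.
have al0 : 0 <= al by rewrite mulr_ge0// divr_ge0// ltW.
have := @hamming_conj_tail R _ x b k al (geq_minr _ _) k0 al0.
have -> : al ^+ 2 / (64 * k%:R) = eps ^+ 2 / 1024 * k%:R.
  by rewrite /al; field; rewrite pnatr_eq0 -lt0n.
apply: le_trans; rewrite unifPE; apply: ler_unifE => p _ /=.
rewrite hammingJ1 far /= mean_hamming_conj// -/(drift n (hamming x 1%g) k).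
have [pr|_] := leqP (hamming (x ^ p)%g b) r; last by rewrite ler0n.
rewrite ler_nat lt0b ler_normr; apply/orP; right.
have dr : eps / 2 * k%:R <= drift n (hamming x 1%g) k.
  apply: drift_ge => //; apply: le_trans r_le; by rewrite ler_nat.
have : (hamming (x ^ p)%g b)%:R <= (hamming x 1%g)%:R + M%:R :> R.
  by rewrite -natrD ler_nat; lia.
rewrite /conj_dist /al; lra.
Qed.

(** The part of the intersection in the ball of radius [r - M - 1] around [a]
    is small by exponential growth, the remaining shell by
    [outer_ball_tail]. *)
Lemma ball_inter a b : 6 / eps <= (hamming a b)%:R :> R ->
    (hamming a b <= 2 * r)%N ->
  unifP (mball (@hamming n) a r%:Z) [pred x | (hamming x b <= r)%N]
    <= 4 * expR (- (eps ^+ 2 / 1024 * (hamming a b)%:R)).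
Proof.
move: (eps_itv) => /andP[e0 e1] ek kr.
have e600 : 600 < 6 / eps by rewrite ltr_pdivlMr//; lra.
have k600 : (600 < hamming a b)%N by rewrite -(ltr_nat R); lra.
have en : 6 / eps <= n%:R :> R by apply: le_trans ek _; rewrite ler_nat hamming_le.
have [_ rn] := radius_lt en.
rewrite unifPE -(mball_shift a) (unifE_reindex _ (@mulIg _ a) (erefl _)).
rewrite (eq_unifE (g := fun x => ((hamming x (b * a^-1)%g <= r)%N)%:R)); last first.
  by move=> x _ /=; rewrite -(hammingMr a x) mulgKV.
have kE : hamming a b = hamming (b * a^-1)%g 1%g by rewrite hammingC hamming_div.
move: ek kr k600; rewrite kE; move: (b * a^-1)%g => {kE a}b.
set k := hamming b 1%g => ek kr k600.
have al0 : 0 <= eps / 4 * k%:R by rewrite mulr_ge0// divr_ge0// ltW.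
pose M := Num.truncn (eps / 4 * k%:R).
have /andP[Mle Mgt] : M%:R <= eps / 4 * k%:R < M.+1%:R by exact: truncn_itv.
(* Growth is only available for radii [r - t] with [t < r]; the hypothesis
   [k <= 2 * r] is what keeps [M + 1] in that range. *)
have Mr : (M.+1 < r)%N.
  rewrite -(ltr_nat R) -natr1.
  have : k%:R <= 2 * r%:R :> R by rewrite -natrM ler_nat.
  have : 600 < k%:R :> R by rewrite (ltr_nat R 600).
  move: Mle; nra.
have outer := @outer_ball_tail b M ek Mle.
have growth := @exponential_growth_hamming n R eps r _ rn 1%g M.+1 Mr.
set B := mball (@hamming n) 1%g r%:Z.
have B0 : 0 < #|B|%:R :> R by apply: (@natr_card_gt0 _ _ _ 1%g); rewrite inE hamming_id.
have inner : unifP B [pred x | (hamming x 1%g + M.+1 <= r)%N]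
    <= 2 * expR (- (eps ^+ 2 / 1024 * k%:R)).
  rewrite /unifP ler_pdivrMr//.
  rewrite (mball_inner (@hamming n)).
  apply: le_trans (growth _) _; first by lra.
  rewrite ler_wpM2r// ler_wpM2l// ler_expR lerN2.
  apply: le_trans (_ : eps * (eps / 4 * k%:R) <= _); last first.
    by rewrite ler_wpM2l// ltW.
  have : 0 <= eps ^+ 2 * k%:R by rewrite mulr_ge0// sqr_ge0.
  rewrite expr2; lra.
have -> : 4 * expR (- (eps ^+ 2 / 1024 * k%:R)) = 2 * expR (- (eps ^+ 2 / 1024 * k%:R))
   + 2 * expR (- (eps ^+ 2 / 1024 * k%:R)) by ring.
apply: le_trans (lerD inner outer).
rewrite !unifPE /unifE -mulrDl -big_split ler_wpM2r ?invr_ge0//= ler_sum// => x _.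
case: (leqP (hamming x b) r) => _; last by rewrite addr_ge0.
by case: leqP; rewrite ?addr0 ?add0r.
Qed.

End Consequence.

Theorem lemma4p4 (R : realType) (eps : R) (eps_gt0 : 0 < eps)
    (eps_lt : eps < 1 / 100) :
  exists c' : R, 0 < c' /\
  forall n r k : nat,
    (0 < n)%N -> (1 <= r)%N -> (0 < k)%N ->
    r%:R <= (1 - eps) * n%:R -> 6 / eps <= k%:R ->
  [/\ exponential_growth (@hamming n) r eps,
      dispersed (@hamming n) r k (eps / 4),
      (forall a b : 'S_n, hamming a b = k ->
       forall i : nat, i%:R <= eps * k%:R / 4 ->
       let A := msphere (@hamming n) a (r%:Z - i%:Z) in
       let l : 'S_n -> R := ell (@hamming n) a b in
       A != set0 ->
       subgaussian A (fun x => l x - unifE A l) (72 * r%:R))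
    & (forall a b : 'S_n, 6 / eps <= (hamming a b)%:R ->
       let D : R := (hamming a b)%:R in
       #|mball (@hamming n) a r%:Z :&: mball (@hamming n) b r%:Z|%:R
         / #|mball (@hamming n) a r%:Z|%:R
       <= 2 * expR (- (c' * (D + D ^+ 2 / r%:R))))].
Proof.
have eps_itv : 0 < eps < 1 / 100 by rewrite eps_gt0.
exists (eps ^+ 2 / 6144); split=> [|n r k n0 r0 k0 rn ek].
  by rewrite divr_gt0// exprn_gt0.
have dist_n (a b : 'S_n) : 6 / eps <= (hamming a b)%:R -> 6 / eps <= n%:R :> R.
  by move=> /le_trans; apply; rewrite ler_nat hamming_le.
have rn' : (r < n)%N.
  rewrite -(ltr_nat R); apply: le_lt_trans rn _.
  have : 0 < n%:R :> R by rewrite ltr0n.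
  nra.
have r0R : 0 < r%:R :> R by rewrite ltr0n.
split.
- by apply: exponential_growth_hamming => //; lra.
- move=> a b abk i _ S0; have [m mE mr] := msphere_radius S0.
  have en : 6 / eps <= n%:R :> R by apply: (dist_n a b); rewrite abk.
  have [n600 _] := radius_lt eps_itv rn en.
  rewrite mE in S0 *; rewrite mean_ell//; last by lia.
  rewrite abk; apply: le_trans (drift_ge k eps_itv _ en); first by lra.
  by apply: le_trans rn; rewrite ler_nat.
- move=> a b abk i _ /= S0 t t0; have [m mE mr] := msphere_radius S0.
  have en : 6 / eps <= n%:R :> R by apply: (dist_n a b); rewrite abk.
  have [n600 _] := radius_lt eps_itv rn en.
  rewrite mE in S0 *.
  apply: le_trans (ell_tail b _ mr r0 t0 S0) _; first by lia.
  rewrite ler_wpM2l// ler_expR lerN2 ler_wpM2l ?sqr_ge0//.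
  by rewrite lef_pV2 ?posrE ?mulr_gt0// ler_wpM2r//; lra.
- move=> a b ek' /=; set D : R := (hamming a b)%:R.
  have D0 : 0 < D by apply: (lt_le_trans _ ek'); rewrite divr_gt0.
  have -> : mball (@hamming n) a r%:Z :&: mball (@hamming n) b r%:Z
      = [set x in mball (@hamming n) a r%:Z | [pred x | (hamming x b <= r)%N] x].
    by apply/setP => x; rewrite !inE lez_nat.
  rewrite -/(unifP _ _).
  have [far|close] := ltnP (2 * r) (hamming a b).
    suff E : [set x in mball (@hamming n) a r%:Z |
        [pred x | (hamming x b <= r)%N] x] = set0.
      by rewrite /unifP E cards0 mul0r mulr_ge0// expR_ge0.
    apply/setP => x; rewrite !inE lez_nat /=; apply/negP => /andP[xa xb].
    by have := hamming_triangle x a b; rewrite (hammingC a x); lia.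
  have tail := ball_inter eps_itv rn ek' close.
  have : unifP (mball (@hamming n) a r%:Z) [pred x | (hamming x b <= r)%N] <= 1 :> R.
    have B0 : 0 < #|mball (@hamming n) a r%:Z|%:R :> R.
      by apply: (@natr_card_gt0 _ _ _ a); rewrite inE hamming_id.
    rewrite /unifP ler_pdivrMr// mul1r ler_nat.
    by apply/subset_leq_card/subsetP => x; rewrite inE => /andP[].
  move: tail; set P := unifP _ _; move=> tail P1.
  pose y := expR (- (eps ^+ 2 / 2048 * D)).
  (* Halving the exponent absorbs the constant 4: a number that is at most 1
     and at most [4 * y ^ 2] is at most [2 * y]. *)
  have yy : expR (- (eps ^+ 2 / 1024 * D)) = y ^+ 2.
    by rewrite [RHS]expr2 -expRD; congr expR; field.
  have y0 : 0 < y := expR_gt0 _.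
  apply: le_trans (_ : 2 * y <= _).
    by move: tail; rewrite -/D yy; nra.
  rewrite ler_wpM2l// ler_expR lerN2.
  have DDr : D ^+ 2 / r%:R <= 2 * D.
    have Dr : D <= 2 * r%:R by rewrite -natrM ler_nat.
    by rewrite ler_pdivrMr//; nra.
  have e2 : 0 <= eps ^+ 2 by exact: sqr_ge0.
  apply: le_trans (_ : eps ^+ 2 / 6144 * (D + 2 * D) <= _); last by lra.
  by rewrite ler_wpM2l ?lerD2l// divr_ge0.
Qed.
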